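(* Let $W$ be $H$-stable, $m\in(1,\infty)$ and $\beta>0$. Then $\mathcal F_\beta^m$ has a unique minimiser over $\mathcal P(\Omega)$, namely $\rho=\rho_\infty$.
   Context: $\Omega=\mathbb T^d$ is the torus of side length $L>0$, $\rho_\infty:=L^{-d}=|\Omega|^{-1}$; $\mathcal P(\Omega)$ is the set of Borel probability measures on $\Omega$, identified with their densities when these exist. $W\in C^2(\Omega)$ is even along every coordinate and has mean zero. For $m>1$, $$\mathcal F_\beta^m(\rho)=\frac{\beta^{-1}}{m-1}\int_\Omega\rho^m\,dx-\frac{\beta^{-1}}{m-1}+\frac12\iint_{\Omega\times\Omega}W(x-y)\rho(x)\rho(y)\,dx\,dy$$ whenever these quantities are finite, and $+\infty$ otherwise. Fourier conventions: for $k\in\mathbb Z^d$, $e_k(x)=N_k\prod_{i=1}^d e_{k_i}(x_i)$ with $e_{k_i}(x_i)=\cos(2\pi k_ix_i/L)$ if $k_i>0$, $1$ if $k_i=0$, $\sin(2\pi k_ix_i/L)$ if $k_i<0$; $N_k=L^{-d/2}\prod_{i=1}^d(2-\delta_{k_i,0})^{1/2}$; $\hat W(k)=\langle W,e_k\rangle_{L^2(\Omega)}$. $W$ is $H$-stable if $\hat W(k)\ge0$ for all $k\in\mathbb Z^d$, $k\ne0$. *)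

(* Defs.v *)
From HB Require Import structures.
From mathcomp Require Import all_boot all_order all_algebra.
From mathcomp Require Import all_classical all_reals all_analysis.

Set Implicit Arguments.
Unset Strict Implicit.
Unset Printing Implicit Defensive.

Import Order.TTheory GRing.Theory Num.Theory.
Import numFieldNormedType.Exports.

Local Open Scope classical_set_scope.
Local Open Scope ring_scope.

(* The torus of side length L is represented by its fundamental domain
   [0, L)^d: functions on the torus are the functions on R^d that are
   L-periodic in every coordinate, and Borel measures on the torus are the
   Borel measures on R^d carried by [0, L)^d.  Two models of R^d are needed:
   d-tuples carry the product (Borel) sigma-algebra, row vectors carry the
   norm used for derivatives. *)

Notation Rpoint R d := (d.-tuple (measurableTypeR R)).

Definition vec (R : realType) (d : nat) (x : Rpoint R d) : 'rV[R]_d :=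
  \row_i tnth x i.

Definition cell (R : realType) (L : R) (d : nat) : set (Rpoint R d) :=
  [set x | forall i, tnth x i \in `[0, L[].
Arguments cell {R} L d _.

Section torus_volume.
Variables (R : realType) (L : R).

Lemma measurable_side :
  measurable (`[0, L[%classic : set (measurableTypeR R)).
Proof. exact: (@measurable_itv R). Qed.

Lemma lebesgue_side_lty :
  (lebesgue_measure (`[0%R, L[%classic : set (measurableTypeR R)) < +oo)%E.
Proof. by rewrite lebesgue_measure_itv/=; case: ifP => // _; rewrite ltry. Qed.

Definition side_volume :
    {finite_measure set (measurableTypeR R) -> \bar R} :=
  mfrestr measurable_side lebesgue_side_lty.

Definition point_cons (n : nat) (xt : measurableTypeR R * Rpoint R n) :
  Rpoint R n.+1 := [tuple of xt.1 :: xt.2].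

Lemma measurable_point_cons n : measurable_fun setT (@point_cons n).
Proof. exact: measurable_cons. Qed.

Section cons_volume.
Variables (n : nat) (mu : {finite_measure set (Rpoint R n) -> \bar R}).

Definition cons_volume : set (Rpoint R n.+1) -> \bar R :=
  pushforward (side_volume \x mu)%E (@point_cons n).

Let measurable_cons_n := @measurable_point_cons n.

Let cons_volume0 : cons_volume set0 = 0%E.
Proof. exact: measure0. Qed.

Let cons_volume_ge0 A : (0 <= cons_volume A)%E.
Proof. exact: measure_ge0. Qed.

Let cons_volume_sigma_additive : semi_sigma_additive cons_volume.
Proof. exact: measure_semi_sigma_additive. Qed.

HB.instance Definition _ := isMeasure.Build _ _ _ cons_volume
  cons_volume0 cons_volume_ge0 cons_volume_sigma_additive.

Let cons_volume_finite : fin_num_fun cons_volume.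
Proof.
apply: lty_fin_num_fun => /=.
rewrite -[cons_volume _]/((side_volume \x mu)%E setT) -setXTT.
by rewrite product_measure1E// lte_mul_pinfty// ?ltey_eq ?fin_num_measure.
Qed.

HB.instance Definition _ := Measure_isFinite.Build _ _ _ cons_volume
  cons_volume_finite.

End cons_volume.

Fixpoint torus_volume (n : nat) :
    {finite_measure set (Rpoint R n) -> \bar R} :=
  if n is n'.+1 then cons_volume (torus_volume n') else \d_[tuple].
End torus_volume.

Section torus_functions.
Variables (R : realType) (L : R) (d : nat).
Implicit Types W : 'rV[R]_d -> R.

Definition unit_vec (i : 'I_d) : 'rV[R]_d := delta_mx ord0 i.

Definition partial (i : 'I_d) W : 'rV[R]_d -> R :=
  fun x => 'D_(unit_vec i) W x.

Definition torus_periodic W : Prop :=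
  forall (i : 'I_d) x, W (x + L *: unit_vec i) = W x.

Definition C2 W : Prop :=
  [/\ continuous W,
      forall i, (forall x, derivable W x (unit_vec i)) /\
                continuous (partial i W)
    & forall i j, (forall x, derivable (partial i W) x (unit_vec j)) /\
                  continuous (partial j (partial i W))].

Definition coordinate_even W : Prop :=
  forall (i : 'I_d) (x : 'rV[R]_d),
    W (\row_j (if j == i then - x ord0 j else x ord0 j)) = W x.

Definition mean_zero W : Prop :=
  \int[torus_volume L d]_x W (vec x) = 0.

Definition fourier_basis1 (k : int) (t : R) : R :=
  if 0 < k then cos (2 * pi * k%:~R * t / L)
  else if k == 0 then 1
  else sin (2 * pi * k%:~R * t / L).

Definition fourier_norm (k : 'rV[int]_d) : R :=
  L `^ (- (d%:R / 2)) * \prod_(i < d) Num.sqrt (2 - (k ord0 i == 0)%:R).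

Definition fourier_basis (k : 'rV[int]_d) (x : 'rV[R]_d) : R :=
  fourier_norm k * \prod_(i < d) fourier_basis1 (k ord0 i) (x ord0 i).

Definition fourier_coef W (k : 'rV[int]_d) : R :=
  \int[torus_volume L d]_x (W (vec x) * fourier_basis k (vec x)).

Definition H_stable W : Prop :=
  forall k : 'rV[int]_d, k != 0 -> 0 <= fourier_coef W k.

End torus_functions.

Section free_energy.
Variables (R : realType) (L : R) (d : nat) (W : 'rV[R]_d -> R) (beta m : R).
Implicit Types (mu : probability (Rpoint R d) R) (rho : Rpoint R d -> R).

Let vol := torus_volume L d.

Definition on_torus mu : Prop := mu (cell L d) = 1%E.

(* As vol is carried by the cell, only the values of rho there matter. *)
Definition is_density mu rho : Prop :=
  [/\ measurable_fun setT rho,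
      forall x, 0 <= rho x
    & forall A, measurable A -> mu A = (\int[vol]_(x in A) (rho x)%:E)%E].

Definition interaction rho (z : Rpoint R d * Rpoint R d) : R :=
  W (vec z.1 - vec z.2) * rho z.1 * rho z.2.

Definition finite_energy rho : Prop :=
  vol.-integrable setT (fun x => (rho x `^ m)%:E) /\
  (vol \x vol)%E.-integrable setT (fun z => (interaction rho z)%:E).

Definition density_energy rho : R :=
  beta^-1 / (m - 1) * (\int[vol]_x (rho x `^ m)) - beta^-1 / (m - 1)
  + 2^-1 * \int[(vol \x vol)%E]_z interaction rho z.

(* The density is unique up to vol-null sets, so the value below does not
   depend on the one chosen by cid; a measure without density has energy +oo. *)
Definition free_energy mu : \bar R :=
  match pselect (exists rho, is_density mu rho /\ finite_energy rho) with
  | left ex_rho => (density_energy (sval (cid ex_rho)))%:E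
  | right _ => +oo%E
  end.

Definition is_minimiser mu : Prop :=
  on_torus mu /\
  forall nu : probability (Rpoint R d) R,
    on_torus nu -> (free_energy mu <= free_energy nu)%E.

End free_energy.

(* Main.v *)
Require Import Defs.
From HB Require Import structures.
From mathcomp Require Import all_boot all_order all_algebra.
From mathcomp Require Import all_classical all_reals all_analysis.
From mathcomp Require Import measurable_realfun ring lra.
Import Order.TTheory GRing.Theory Num.Theory.
Import numFieldNormedType.Exports.
Local Open Scope classical_set_scope.
Local Open Scope ring_scope.

(** The free energy of a density f is a positive multiple of the integral of
    f ^ m, plus half of the interaction energy, up to a constant.  The uniform
    density minimises both terms at once, and is the only minimiser of the
    first one.

    Power term.  The strictly convex function t |-> t ^ m lies above its tangent
    at the value of the uniform density.  Since all probability densities have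
    the same integral, integrating the tangent inequality gives the bound
    [Rintegral_powR_ge], and equality forces the density to be uniform almost
    everywhere ([Rintegral_powR_le_ae]).

    Interaction term.  If W is a finite sum of a_k prod_i cos (2 pi k_i z_i / L)
    with a_k >= 0, then expanding cos (x_i - y_i) turns the interaction energy
    into a nonnegative combination of squares of Fourier coefficients of f
    ([box_modeB], [spectral_energy]).  A general W is reached by uniform
    approximation: W is replaced by its Fejer means, whose coefficients are
    those of W times positive weights, hence nonnegative by H-stability
    ([cos_coef_ge0]).  As the total mass of f is one, a uniform error on W bounds
    the error on the interaction energy ([interaction_approx]).  So the
    interaction energy is nonnegative, and it vanishes for the uniform
    density, whose Fourier coefficients of nonzero frequency are zero, while the
    coefficient of frequency zero is multiplied by the mean of W.

    Uniform convergence of the Fejer means follows Korovkin's argument.  Being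
    even and periodic in each coordinate, W is a continuous function of the
    cosines of its coordinates, so that by compactness
      |W x - W y| <= e + C sum_i (cos (2 pi x_i / L) - cos (2 pi y_i / L)) ^ 2
    ([W_oscillation]).  The kernel obtained by keeping only the cosine modes is
    nonnegative, has mass one, and gives each square on the right the mean
    value 1 / N exactly ([fejer_variance]).  No reflection or translation of the
    integration variable is ever performed: evenness and periodicity of W enter
    through this pointwise bound only. *)

Set Implicit Arguments.
Unset Strict Implicit.
Unset Printing Implicit Defensive.

(** * Integrals of products and of finite sums *)

Section tensor.
Context d1 d2 (T1 : measurableType d1) (T2 : measurableType d2) (R : realType).
Variables (m1 : {sigma_finite_measure set T1 -> \bar R})
  (m2 : {sigma_finite_measure set T2 -> \bar R}).
Variables (f : T1 -> R) (h : T2 -> R).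
Hypothesis (intf : m1.-integrable setT (EFin \o f)).
Hypothesis (inth : m2.-integrable setT (EFin \o h)).

Lemma integrable_tensor :
  (m1 \x m2)%E.-integrable setT (fun z => (f z.1 * h z.2)%:E).
Proof.
have mf : measurable_fun setT f.
  by apply/measurable_EFinP; exact: measurable_int intf.
have mh : measurable_fun setT h.
  by apply/measurable_EFinP; exact: measurable_int inth.
apply/integrable12ltyP.
  apply/measurable_EFinP; apply: measurable_funM => //=.
    exact: measurableT_comp.
  exact: measurableT_comp.
under eq_integral => x _.
  under eq_integral => y _ do rewrite /= normrM EFinM.
  rewrite ge0_integralZl//; last first.
    by do 2 apply: measurableT_comp => //.
  over.
have /integrableP[_ hoo] := inth.
have /integrableP[_ foo] := intf.
rewrite ge0_integralZr//; last 2 first.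
- by do 2 apply: measurableT_comp => //.
- exact: integral_ge0.
apply: lte_mul_pinfty => //; first exact: integral_ge0.
by rewrite ge0_fin_numE//; exact: integral_ge0.
Qed.

Lemma Rintegral_tensor :
  \int[(m1 \x m2)%E]_z (f z.1 * h z.2) = (\int[m1]_x f x) * (\int[m2]_y h y).
Proof.
rewrite /Rintegral -integral12_prod_meas1; last exact: integrable_tensor.
rewrite /fubini_F/=.
under eq_integral => x _.
  under eq_integral => y _ do rewrite EFinM.
  rewrite integralZl//.
  over.
have hfin := integrable_fin_num measurableT inth.
rewrite -fineM//; last exact: (integrable_fin_num measurableT intf).
congr fine.
have -> : (\int[m2]_y (h y)%:E)%E = (fine (\int[m2]_y (h y)%:E))%:E.
  by rewrite fineK.
by rewrite integralZr.
Qed.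
End tensor.

Section Rintegral_sum.
Context d (T : measurableType d) (R : realType) (mu : {measure set T -> \bar R}).

Lemma integrable_Rsum (I : Type) (s : seq I) (F : I -> T -> R) :
  (forall i, mu.-integrable setT (EFin \o F i)) ->
  mu.-integrable setT (EFin \o (fun x => \sum_(i <- s) F i x)).
Proof.
move=> intF.
have := @integrable_sum _ _ _ mu setT measurableT _ s xpredT
  (fun i => EFin \o F i).
move=> /(_ (fun i _ => intF i)); apply: eq_integrable => // x _ /=.
by rewrite sumEFin.
Qed.

Lemma Rintegral_sum (I : Type) (s : seq I) (F : I -> T -> R) :
  (forall i, mu.-integrable setT (EFin \o F i)) ->
  \int[mu]_x (\sum_(i <- s) F i x) = \sum_(i <- s) \int[mu]_x F i x.
Proof.
move=> intF; elim: s => [|i s IH].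
  rewrite big_nil; under eq_Rintegral do rewrite big_nil.
  by rewrite Rintegral_cst// mul0r.
rewrite big_cons -IH -RintegralD//; last exact: integrable_Rsum.
by apply: eq_Rintegral => x _; rewrite big_cons.
Qed.

Lemma integrable_RZ (r : R) (F : T -> R) :
  mu.-integrable setT (EFin \o F) ->
  mu.-integrable setT (EFin \o (fun x => r * F x)).
Proof.
by move=> /(integrableZl measurableT r); apply: eq_integrable => // x _ /=.
Qed.

Lemma integrable_bounded_mul (f g : T -> R) (M : R) :
  measurable_fun setT f -> (forall x, `|f x| <= M) ->
  mu.-integrable setT (EFin \o g) ->
  mu.-integrable setT (EFin \o (fun x => f x * g x)).
Proof.
move=> mf fM ig.
apply: (@le_integrable _ _ _ mu setT measurableT _ (EFin \o (fun x => M * g x))).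
- apply/measurable_EFinP; apply: measurable_funM => //.
  by apply/measurable_EFinP; exact: measurable_int ig.
- move=> x _ /=; rewrite lee_fin !normrM ler_wpM2r//.
  by rewrite (le_trans (fM x))// ler_norm.
- exact: integrable_RZ.
Qed.
End Rintegral_sum.

Lemma bounded_integrable d (T : measurableType d) (R : realType)
    (mu : {finite_measure set T -> \bar R}) (f : T -> R) (M : R) :
  measurable_fun setT f -> (forall x, `|f x| <= M) ->
  mu.-integrable setT (EFin \o f).
Proof.
move=> mf fM; have := @integrable_bounded_mul _ _ _ mu f (cst 1) M mf fM.
move=> /(_ (finite_measure_integrable_cst mu 1 measurableT)).
by apply: eq_integrable => // x _ /=; rewrite mulr1.
Qed.

(** * Integration over one side and over the torus *)

Section side.
Variables (R : realType) (L : R).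
Hypothesis L_gt0 : 0 < L.
Local Notation side := (side_volume L).

Lemma continuous_bounded_side (f : R -> R) (M : R) : continuous f ->
  (forall x, `|f x| <= M) -> side.-integrable setT (EFin \o f).
Proof.
move=> cf fM; apply: (@bounded_integrable _ _ _ side f M) => //.
exact: continuous_measurable_fun.
Qed.

(** The two measures differ only by the right end point, which is null; on the
    closed interval the fundamental theorem of calculus applies. *)
Lemma side_Rintegral (f : R -> R) : continuous f ->
  side.-integrable setT (EFin \o f) ->
  \int[side]_x f x = \int[lebesgue_measure]_(x in `[0, L]) f x.
Proof.
move=> cf intf.
have mf : measurable_fun setT f by exact: continuous_measurable_fun.
rewrite /Rintegral -integral_itv_bndo_bndc//; last first.
  by apply/measurable_EFinP; exact: measurable_funTS.
congr fine.
have mD := @measurable_side R L.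
rewrite (@negligible_integral _ _ _ side setT (~` `[0, L[%classic))//=.
- rewrite setTD setCK; apply: eq_measure_integral => A mA AD /=.
  by rewrite /side_volume/= /mfrestr /mrestr setIidl.
- exact: measurableC.
- by rewrite /mfrestr/= /mrestr setICl measure0.
Qed.

Lemma side_volumeE : side setT = L%:E.
Proof.
rewrite /side_volume/= /mfrestr/= /mrestr setTI.
by rewrite lebesgue_measure_itv/= lte_fin L_gt0 oppr0 adde0.
Qed.

Lemma side_Rintegral_cst (c : R) : \int[side]_x c = c * L.
Proof. by rewrite Rintegral_cst//= side_volumeE. Qed.

Lemma side_FTC2 (f F : R -> R) : continuous f ->
  side.-integrable setT (EFin \o f) ->
  (forall x : R, is_derive x (1 : R) F (f x)) ->
  \int[side]_x f x = F L - F 0.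
Proof.
move=> cf intf dF; rewrite side_Rintegral// /Rintegral.
have cF : continuous F.
  move=> x; apply: differentiable_continuous; apply/derivable1_diffP.
  by case: (dF x).
rewrite (@continuous_FTC2 _ f F)//.
- exact: continuous_subspaceT.
- split.
  + by move=> x _; case: (dF x).
  + exact/cvg_at_right_filter/cF.
  + exact/cvg_at_left_filter/cF.
- by move=> x _; rewrite derive1E; apply: derive_val.
Qed.

Definition freq (k : nat) : R := 2 * pi * k%:R / L.

Lemma continuous_cosM (a : R) : continuous (fun t : R => cos (a * t)).
Proof.
move=> t; apply: continuous_comp; last exact: continuous_cos.
by apply: cvgM; [exact: cvg_cst|exact: cvg_id].
Qed.

Lemma continuous_sinM (a : R) : continuous (fun t : R => sin (a * t)).
Proof.
move=> t; apply: continuous_comp; last exact: continuous_sin.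
by apply: cvgM; [exact: cvg_cst|exact: cvg_id].
Qed.

Lemma cos_pi2n k : cos (2 * pi * k%:R : R) = 1.
Proof.
rewrite -[RHS](cos0 R) -[RHS](periodicn (@cosD2pi R) k 0) add0r.
congr cos; rewrite -[RHS]mulr_natr -[pi *+ 2]mulr_natr; ring.
Qed.

Lemma sin_pi2n k : sin (2 * pi * k%:R : R) = 0.
Proof.
rewrite -[RHS](sin0 R) -[RHS](periodicn (@sinD2pi R) k 0) add0r.
congr sin; rewrite -[RHS]mulr_natr -[pi *+ 2]mulr_natr; ring.
Qed.

Lemma freqL k : freq k * L = 2 * pi * k%:R.
Proof. by rewrite /freq divfK// gt_eqF. Qed.

Lemma side_cos k : (0 < k)%N -> \int[side]_t cos (freq k * t) = 0.
Proof.
move=> k0; have w0 : freq k != 0.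
  by rewrite /freq !mulf_neq0// ?invr_neq0 ?gt_eqF// ?pi_gt0 ?ltr0n.
have ci : side.-integrable setT (EFin \o (fun t : R => cos (freq k * t))).
  apply: (@continuous_bounded_side _ 1); first exact: continuous_cosM.
  by move=> x; exact: cos_max.
have dF (x : R) : is_derive x (1 : R)
    (fun t : R => (freq k)^-1 * sin (freq k * t)) (cos (freq k * x)).
  by apply: is_derive_eq; rewrite /GRing.scale/=; field.
rewrite (side_FTC2 (@continuous_cosM _) ci dF).
by rewrite freqL sin_pi2n !mulr0 sin0 mulr0 subr0.
Qed.

Lemma side_sin k : \int[side]_t sin (freq k * t) = 0.
Proof.
have [k0|k0] := posnP k.
  rewrite k0 /freq mulr0 mul0r; under eq_Rintegral do rewrite mul0r sin0.
  by rewrite side_Rintegral_cst mul0r.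
have w0 : freq k != 0.
  by rewrite /freq !mulf_neq0// ?invr_neq0 ?gt_eqF// ?pi_gt0 ?ltr0n.
have ci : side.-integrable setT (EFin \o (fun t : R => sin (freq k * t))).
  apply: (@continuous_bounded_side _ 1); first exact: continuous_sinM.
  by move=> x; exact: sin_max.
have dF (x : R) : is_derive x (1 : R)
    (fun t : R => - (freq k)^-1 * cos (freq k * t)) (sin (freq k * x)).
  by apply: is_derive_eq; rewrite /GRing.scale/=; field.
rewrite (side_FTC2 (@continuous_sinM _) ci dF).
by rewrite freqL cos_pi2n !mulr0 cos0 subrr.
Qed.

(** The volume is an iterated product, so Fubini's theorem and induction on the
    dimension reduce every integral needed on the torus to one-dimensional
    ones. *)
Lemma torus_integral_prod n (g : 'I_n -> R -> R) :
  (forall i, side.-integrable setT (EFin \o g i)) ->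
  (torus_volume L n).-integrable setT (fun x => (\prod_i g i (tnth x i))%:E) /\
  \int[torus_volume L n]_x \prod_i g i (tnth x i) = \prod_i \int[side]_t g i t.
Proof.
elim: n g => [|n IH] g ig.
  rewrite big_ord0; under eq_Rintegral do rewrite big_ord0.
  split; last first.
    by rewrite Rintegral_cst//= mul1r indicT.
  have := finite_measure_integrable_cst (torus_volume L 0) (1 : R) measurableT.
  apply: (@eq_integrable _ _ _ (torus_volume L 0) setT measurableT) => x _.
  by rewrite /= big_ord0.
have [ig' Eg'] := IH (fun i => g (lift ord0 i)) (fun i => ig (lift ord0 i)).
have mg : measurable_fun setT
    (fun x : Rpoint R n.+1 => \prod_i g i (tnth x i)).
  apply: measurable_prod => i _; apply: measurableT_comp.
    by apply/measurable_EFinP; exact: measurable_int (ig i).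
  exact: measurable_tnth.
have gE (z : measurableTypeR R * Rpoint R n) :
    \prod_i g i (tnth (point_cons z) i) =
    g ord0 z.1 * \prod_i g (lift ord0 i) (tnth z.2 i).
  rewrite big_ord_recl; congr (_ * _).
  by apply: eq_bigr => i _; rewrite /point_cons tnthS.
have ig2 := integrable_tensor (ig ord0) ig'.
have ip : (side \x torus_volume L n)%E.-integrable
    (@point_cons R n @^-1` setT)
    ((fun x => (\prod_i g i (tnth x i))%:E) \o @point_cons R n).
  rewrite preimage_setT; apply: eq_integrable ig2 => // z _.
  by rewrite /= gE.
have mp := @measurable_point_cons R n.
split.
  apply: (@integrable_pushforward _ _ _ _ _ _ mp) => //.
  exact/measurable_EFinP.
rewrite /Rintegral (@integral_pushforward _ _ _ _ _ _ mp) //; last first.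
  exact/measurable_EFinP.
rewrite preimage_setT big_ord_recl/= -Eg' -Rintegral_tensor//.
by congr fine; apply: eq_integral => z _; rewrite /= gE.
Qed.

Lemma torus_volumeT n : torus_volume L n setT = (L ^+ n)%:E.
Proof.
have [_] := @torus_integral_prod n (fun=> cst 1)
  (fun i => finite_measure_integrable_cst side 1 measurableT).
under eq_Rintegral do rewrite big1_eq.
rewrite Rintegral_cst// mul1r side_Rintegral_cst mul1r prodr_const card_ord => <-.
by rewrite fineK// fin_num_measure.
Qed.

Lemma measurable_cell n : measurable (cell L n).
Proof.
have -> : cell L n = \bigcap_i ((@tnth n R)^~ i @^-1` `[0, L[%classic).
  by apply/seteqP; split => [x cx i _|x cx i]; [exact: cx|exact: cx].
apply: fin_bigcap_measurable => [|i _]; first exact: finite_finset.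
rewrite -[X in measurable X]setTI.
exact: (@measurable_tnth _ (measurableTypeR R) n i).
Qed.

(** The indicator of the cell is the product of the indicators of its sides. *)
Lemma torus_volume_cell n : torus_volume L n (cell L n) = (L ^+ n)%:E.
Proof.
pose I : measurableTypeR R -> R := \1_(`[0, L[%classic).
have mI : measurable_fun setT I.
  by apply: measurable_indic; exact: measurable_side.
have iI : side.-integrable setT (EFin \o I).
  apply: (@bounded_integrable _ _ _ _ _ 1) => // x.
  by rewrite /I indicE; case: (_ \in _); rewrite ?normr1 ?normr0.
have [_] := @torus_integral_prod n (fun=> I) (fun=> iI).
rewrite prodr_const card_ord.
have -> : \int[side]_t I t = L.
  rewrite /Rintegral integral_indic//.
  rewrite setIT/= /mfrestr /mrestr setIid lebesgue_measure_itv/= lte_fin L_gt0.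
  by rewrite oppr0 addr0.
move=> <-.
rewrite -[LHS]fineK ?fin_num_measure//; last exact: measurable_cell.
congr EFin; rewrite -[X in fine (_ X)]setIT -integral_indic//; last first.
  exact: measurable_cell.
apply: eq_Rintegral => x _.
rewrite indicE; have [/set_mem cx|/negP cx] := boolP (x \in cell L n).
  by rewrite big1// => i _; rewrite /I indicE mem_set//; exact: cx.
apply/esym/eqP/prodf_eq0.
have /existsNP[i ni] : ~ (forall i, tnth x i \in `[0, L[).
  by move=> h; apply: cx; apply/mem_set => i; exact: h.
by exists i => //; rewrite /I indicE memNset.
Qed.
End side.

(** * The Fejer kernel in one variable *)

Section fejer.
Variables (R : realType) (L : R).
Hypothesis L_gt0 : 0 < L.
Local Notation side := (side_volume L).

Definition mode (k : nat) (t : R) : R := cos (freq L k * t).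

Lemma mode0 t : mode 0 t = 1.
Proof. by rewrite /mode /freq mulr0 !mul0r cos0. Qed.

Lemma mode_le1 k t : `|mode k t| <= 1.
Proof. exact: cos_max. Qed.

Lemma continuous_mode k : continuous (mode k).
Proof. exact: continuous_cosM. Qed.

Lemma freqD i k : freq L (i + k) = freq L i + freq L k.
Proof. by rewrite /freq natrD mulrDr mulrDl. Qed.

Lemma modeM i k t :
  mode i t * mode (i + k) t = 2^-1 * (mode k t + mode (i + i + k) t).
Proof.
rewrite /mode !freqD !mulrDl.
set a := freq L i * t; set b := freq L k * t.
have -> : cos (a + a + b) = cos ((a + b) + a) by congr cos; ring.
have -> : cos b = cos ((a + b) - a) by congr cos; ring.
by rewrite cosB (cosD (a + b) a); field.
Qed.

Lemma mode_sqr t : mode 1 t ^+ 2 = 2^-1 * (1 + mode 2 t).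
Proof. by have := modeM 1 0 t; rewrite addn0 mode0 expr2. Qed.

Lemma integrable_mode k : side.-integrable setT (EFin \o mode k).
Proof.
apply: (@continuous_bounded_side _ _ _ 1); first exact: continuous_mode.
exact: mode_le1.
Qed.

Lemma integrable_modeM i k :
  side.-integrable setT (EFin \o (fun t => mode i t * mode k t)).
Proof.
apply: (@continuous_bounded_side _ _ _ 1) => [t|t].
  by apply: cvgM; exact: continuous_mode.
by rewrite normrM mulr_ile1// mode_le1.
Qed.

Lemma side_mode k : \int[side]_t mode k t = L * (k == 0)%:R.
Proof.
have [->|k0] := posnP k.
  under eq_Rintegral do rewrite mode0.
  by rewrite side_Rintegral_cst// mul1r mulr1.
by rewrite (side_cos L_gt0)// mulr0.
Qed.

Lemma side_modeM i k : \int[side]_t (mode i t * mode k t) =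
  (i == k)%:R * (L / 2) * (1 + (k == 0)%:R).
Proof.
wlog leik : i k / (i <= k)%N => [H|].
  have [/H//|/ltnW/H E] := leqP i k.
  under eq_Rintegral do rewrite mulrC.
  by rewrite E eq_sym; have [->|] := eqVneq k i; rewrite // !mul0r.
rewrite -(subnKC leik).
under eq_Rintegral do rewrite modeM.
rewrite RintegralZl//; last first.
  have := integrableD measurableT (integrable_mode (k - i))
    (integrable_mode (i + i + (k - i))).
  by apply: eq_integrable.
rewrite RintegralD//; [|exact: integrable_mode..].
rewrite !side_mode !addn_eq0.
have -> : (i == i + (k - i))%N = (k - i == 0)%N.
  by rewrite -[X in X == _]addn0 eqn_add2l eq_sym.
case: (k - i == 0)%N; rewrite ?andbT ?andbF; last by rewrite /=; ring.
by case: (i == 0)%N; rewrite /=; field.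
Qed.

(** Up to the factor 1 / (N L), the coefficient of the mode k is N for k = 0 and
    2 (N - k) otherwise; writing both cases as one expression keeps the sums
    over k free of case distinctions. *)
Definition fejer_weight (N k : nat) : R :=
  (N%:R * L)^-1 * (2 * (N%:R - k%:R) - N%:R * (k == 0)%:R).

(** This is the mean of the Fejer kernel F_N at z - u and at z + u: the sine
    terms cancel.  It averages over the reflected point as well, which is
    harmless when acting on even functions. *)
Definition fejer (N : nat) (z u : R) : R :=
  \sum_(k < N) fejer_weight N k * (mode k z * mode k u).

Lemma fejer_weight_ge0 N k : (k < N)%N -> 0 <= fejer_weight N k.
Proof.
move=> kN; rewrite /fejer_weight mulr_ge0//.
  by rewrite invr_ge0 mulr_ge0// ltW.
have kN' : (k%:R : R) <= N%:R by rewrite ler_nat ltnW.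
have [->|_] := eqVneq k 0.
  by rewrite mulr1; have : (0 : R) <= N%:R by []; lra.
by rewrite mulr0; lra.
Qed.

(** The right-hand side is the squared modulus of a geometric sum, the usual
    reason why the Fejer kernel is nonnegative.  Going from N to N + 1 adds the
    Dirichlet kernel 1 + 2 sum_(1 <= k <= N) cos (k x) to both sides. *)
Lemma fejer_square N (x : R) :
  \sum_(k < N) (2 * (N%:R - k%:R) - N%:R * ((k : nat) == 0)%:R) * cos (k%:R * x) =
  (\sum_(k < N) cos (k%:R * x)) ^+ 2 + (\sum_(k < N) sin (k%:R * x)) ^+ 2.
Proof.
pose S n := \sum_(k < n) cos (k%:R * x).
have E n : \sum_(k < n)
    (2 * (n%:R - k%:R) - n%:R * ((k : nat) == 0)%:R) * cos (k%:R * x) =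
    2 * (\sum_(k < n) (n%:R - k%:R) * cos (k%:R * x)) - n%:R.
  under eq_bigr do rewrite mulrBl -!mulrA.
  rewrite sumrB -!mulr_sumr; congr (_ - _).
  case: n => [|n]; first by rewrite mul0r.
  rewrite big_ord_recl/= mul0r cos0 mulr1 big1 ?addr0 ?mulr1// => k _.
  by rewrite mul0r.
elim: N => [|N IH]; first by rewrite !big_ord0 expr0n/= addr0.
rewrite E in IH; rewrite E.
rewrite !(big_ord_recr N)/=.
have -> : \sum_(k < N) (N.+1%:R - k%:R) * cos (k%:R * x) =
   \sum_(k < N) (N%:R - k%:R) * cos (k%:R * x) + S N.
  rewrite -big_split/=; apply: eq_bigr => k _; rewrite -natr1; ring.
have key : cos (N%:R * x) * S N + sin (N%:R * x) * (\sum_(k < N) sin (k%:R * x))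
    = S N + cos (N%:R * x) - 1.
  rewrite /S !mulr_sumr -big_split/=.
  have -> : \sum_(k < N) cos (k%:R * x) + cos (N%:R * x) - 1 =
    \sum_(k < N) cos (k.+1%:R * x).
    rewrite -(big_ord_recr N (fun k : 'I_N.+1 => cos (k%:R * x))).
    rewrite big_ord_recl/= mul0r cos0.
    by rewrite addrAC subrr add0r.
  rewrite [RHS](reindex_inj rev_ord_inj)/=; apply: eq_bigr => k _.
  by rewrite -cosB -mulrBl subnSK// natrB// ltnW.
rewrite -/(S N) in IH *.
have cs := cos2Dsin2 (N%:R * x).
move: IH key cs.
move: (\sum_(k < N) (N%:R - k%:R) * _) (\sum_(k < N) sin _) (S N) => T B A.
move: (cos _) (sin _) => c s IH key cs.
have -> : (A + c) ^+ 2 + (B + s) ^+ 2 =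
  (A ^+ 2 + B ^+ 2) + 2 * (c * A + s * B) + (c ^+ 2 + s ^+ 2) by ring.
by rewrite key cs -IH -natr1; ring.
Qed.

(** The kernel is half the sum of the values of the Fejer kernel at z - u and
    z + u, both nonnegative. *)
Lemma fejer_ge0 N z u : 0 <= fejer N z u.
Proof.
pose w : R := 2 * pi / L.
pose K (x : R) := \sum_(k < N)
  (2 * (N%:R - k%:R) - N%:R * ((k : nat) == 0)%:R) * cos (k%:R * x).
have -> : fejer N z u = (N%:R * L)^-1 / 2 * (K (w * (z - u)) + K (w * (z + u))).
  rewrite /fejer /K -big_split/= mulr_sumr; apply: eq_bigr => k _.
  rewrite /fejer_weight /mode -mulrDr.
  have E (t : R) : k%:R * (w * t) = freq L k * t by rewrite /w /freq; ring.
  rewrite !E (mulrBr (freq L k)) (mulrDr (freq L k)) cosB cosD; field.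
  by rewrite (gt_eqF L_gt0) pnatr_eq0 -lt0n (leq_ltn_trans _ (ltn_ord k)).
rewrite mulr_ge0//; first by rewrite divr_ge0// invr_ge0 mulr_ge0// ltW.
by rewrite /K !fejer_square !addr_ge0 ?sqr_ge0.
Qed.

Lemma integrable_modeM_fejer N i z :
  side.-integrable setT (EFin \o (fun u => mode i u * fejer N z u)).
Proof.
have := @integrable_Rsum _ _ _ side _ (index_enum 'I_N)
  (fun (k : 'I_N) u => fejer_weight N k * mode k z * (mode i u * mode k u)).
move=> /(_ (fun k => integrable_RZ _ (integrable_modeM i k))).
apply: eq_integrable => // u _ /=; congr EFin.
rewrite /fejer mulr_sumr; apply: eq_bigr => k _; ring.
Qed.

(** By orthogonality only the term of index i of the kernel contributes, and the
    weights were chosen so that it damps the mode i by the factor 1 - i / N. *)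
Lemma fejer_mode N i z : (i < N)%N ->
  \int[side]_u (mode i u * fejer N z u) = (1 - i%:R / N%:R) * mode i z.
Proof.
move=> iN.
have N0 : (N%:R : R) != 0 by rewrite pnatr_eq0 -lt0n (leq_ltn_trans _ iN).
transitivity (\int[side]_u \sum_(k < N)
    (fejer_weight N k * mode k z * (mode i u * mode k u))).
  apply: eq_Rintegral => u _.
  rewrite /fejer mulr_sumr; apply: eq_bigr => k _; ring.
rewrite Rintegral_sum; last by move=> k; exact/integrable_RZ/integrable_modeM.
under eq_bigr => k _.
  rewrite RintegralZl//; last exact: integrable_modeM.
  rewrite side_modeM; over.
rewrite (bigD1 (Ordinal iN))//= eqxx [X in _ + X]big1; last first.
  move=> k /negPf; rewrite -val_eqE/= eq_sym => ->; by rewrite !mul0r mulr0.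
rewrite /fejer_weight addr0.
case: (i == 0)%N / eqP => [->|_] /=; field; by rewrite N0 gt_eqF.
Qed.

Lemma integrable_fejer N z : side.-integrable setT (EFin \o fejer N z).
Proof.
have := integrable_modeM_fejer N 0 z.
by apply: eq_integrable => // u _ /=; rewrite mode0 mul1r.
Qed.

Lemma fejer_mass N z : (0 < N)%N -> \int[side]_u fejer N z u = 1.
Proof.
move=> N0; have := fejer_mode z N0.
rewrite mode0 mul0r subr0 mulr1 => <-.
by apply: eq_Rintegral => u _; rewrite mode0 mul1r.
Qed.

(** The square is a combination of the modes 0, 1 and 2, on which the kernel acts
    diagonally. *)
Lemma fejer_varianceE N z u : (mode 1 u - mode 1 z) ^+ 2 * fejer N z u =
  (2^-1 + mode 1 z ^+ 2) * (mode 0 u * fejer N z u) +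
  (- (2 * mode 1 z) * (mode 1 u * fejer N z u) +
   2^-1 * (mode 2 u * fejer N z u)).
Proof.
have -> : mode 2 u = 2 * mode 1 u ^+ 2 - 1 by rewrite mode_sqr; field.
by rewrite mode0; field.
Qed.

Lemma integrable_fejer_variance N z : side.-integrable setT
  (EFin \o (fun u => (mode 1 u - mode 1 z) ^+ 2 * fejer N z u)).
Proof.
have I (c : R) i := integrable_RZ c (integrable_modeM_fejer N i z).
have := integrableD measurableT (I (2^-1 + mode 1 z ^+ 2) 0)
  (integrableD measurableT (I (- (2 * mode 1 z)) 1) (I 2^-1 2)).
by apply: eq_integrable => // u _; rewrite /= fejer_varianceE.
Qed.

(** With damping factors r1 = 1 - 1 / N and r2 = 1 - 2 / N the variance is
    (1 - r2) / 2 + (r2 - 2 r1 + 1) cos ^ 2, and the second term vanishes. *)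
Lemma fejer_variance N z : (2 < N)%N ->
  \int[side]_u ((mode 1 u - mode 1 z) ^+ 2 * fejer N z u) = N%:R^-1.
Proof.
move=> N2.
have N0 : (N%:R : R) != 0 by rewrite pnatr_eq0 -lt0n (leq_ltn_trans _ N2).
have I (c : R) i := integrable_RZ c (integrable_modeM_fejer N i z).
under eq_Rintegral do rewrite fejer_varianceE.
rewrite RintegralD//; last first.
  have := integrableD measurableT (I (- (2 * mode 1 z)) 1) (I 2^-1 2).
  by apply: eq_integrable.
rewrite RintegralD// !RintegralZl//; [|exact: integrable_modeM_fejer..].
rewrite !fejer_mode//; [|exact: leq_trans N2..].
have -> : mode 2 z = 2 * mode 1 z ^+ 2 - 1 by rewrite mode_sqr; field.
rewrite mode0; field.
by [].
Qed.
End fejer.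

(** * Even periodic functions and the cosines of the coordinates *)

Section folding.
Variables (R : realType) (L : R).
Hypothesis L_gt0 : 0 < L.

(** Two reals are identified when the group generated by t |-> - t and
    t |-> t + L takes one to the other.  The formulation by invariant functions
    is the one in which the relation is used, and it makes it an equivalence
    relation for free. *)
Definition fold_equiv (s t : R) : Prop :=
  forall (T : Type) (f : R -> T), (forall x, f (- x) = f x) ->
    (forall x, f (x + L) = f x) -> f s = f t.

Lemma fold_equiv_addz s (k : int) : fold_equiv (s + k%:~R * L) s.
Proof.
move=> T f _ fL.
have fn n x : f (x + n%:R * L) = f x.
  elim: n x => [|n IH] x; first by rewrite mul0r addr0.
  by rewrite -natr1 mulrDl mul1r addrA fL IH.
case: k => n; first exact: fn.
by rewrite NegzE mulrNz mulNr -[LHS](fn n.+1) subrK.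
Qed.

(** The segment from 0 to L / 2 is a fundamental domain: reduce modulo L, then
    reflect if needed. *)
Lemma foldP t : exists s, fold_equiv t s /\ s \in `[0, L / 2].
Proof.
pose k := Num.floor (t / L); pose r := t - k%:~R * L.
have tr : fold_equiv t r.
  have := fold_equiv_addz r k.
  by rewrite /r subrK.
have /andP[k1 k2] := floor_itv (t / L).
have r0 : 0 <= r by rewrite subr_ge0 -ler_pdivlMr.
have rL : r < L.
  rewrite ltrBlDl -[X in _ < _ + X]mul1r -mulrDl -ltr_pdivrMr//.
  by rewrite -[1]/(1%:~R) -intrD.
have [rL2|rL2] := lerP r (L / 2).
  by exists r; split => //; rewrite in_itv/= r0.
exists (L - r); split; last by rewrite in_itv/=; apply/andP; split; lra.
move=> T f fN fL; rewrite (tr T f fN fL).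
by rewrite addrC fL fN.
Qed.

Lemma mode_fold s t : fold_equiv s t -> mode L 1 s = mode L 1 t.
Proof.
apply=> x; first by rewrite /mode mulrN cosN.
rewrite /mode mulrDr freqL// mulr1.
by rewrite mulr_natl cosD2pi.
Qed.

(** On the fundamental domain the argument of the cosine runs through the segment
    from 0 to pi, where the cosine is injective. *)
Lemma mode_inj : {in `[0, L / 2] &, injective (mode L 1)}.
Proof.
have w0 : 0 < freq L 1 by rewrite /freq !mulr_gt0// ?invr_gt0// pi_gt0.
have h x : x \in `[0, L / 2] -> freq L 1 * x \in `[0, pi].
  rewrite !in_itv/= => /andP[x0 xL]; rewrite mulr_ge0 ?(ltW w0)//=.
  have -> : pi = freq L 1 * (L / 2) :> R.
    by rewrite mulrA freqL//; field.
  by rewrite ler_pM2l.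
move=> x y /h hx /h hy /(cos_inj hx hy).
by apply: mulfI; rewrite gt_eqF.
Qed.
End folding.

Section potential.
Variables (R : realType) (L : R) (d : nat) (W : 'rV[R]_d -> R).
Hypothesis L_gt0 : 0 < L.
Hypothesis W_periodic : torus_periodic L W.
Hypothesis W_even : coordinate_even W.
Hypothesis cW : continuous W.

Definition set_coord (x : 'rV[R]_d) (i : 'I_d) (t : R) : 'rV[R]_d :=
  \row_j (if j == i then t else x ord0 j).

Lemma W_set_coord x i s t : fold_equiv L s t ->
  W (set_coord x i s) = W (set_coord x i t).
Proof.
move=> /(_ _ (fun t => W (set_coord x i t))); apply => u.
- rewrite -[RHS](W_even i); congr W; apply/rowP => j; rewrite !mxE.
  by case: eqP.
- rewrite -[RHS](W_periodic i); congr W; apply/rowP => j; rewrite !mxE.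
  by have [|] := eqVneq j i; rewrite eqxx ?mulr1 ?mulr0 ?addr0.
Qed.

(** The coordinates are moved one at a time; h n has moved the first n. *)
Lemma W_fold (x y : 'rV[R]_d) :
  (forall i, fold_equiv L (x ord0 i) (y ord0 i)) -> W x = W y.
Proof.
move=> xy.
pose h n : 'rV[R]_d := \row_j (if (j < n)%N then y ord0 j else x ord0 j).
suff H n : (n <= d)%N -> W x = W (h n).
  rewrite (H d (leqnn d)); congr W; apply/rowP => j.
  by rewrite mxE ltn_ord.
elim: n => [|n IH] nd.
  by congr W; apply/rowP => j; rewrite mxE.
rewrite (IH (ltnW nd)).
pose i : 'I_d := Ordinal nd.
have -> : h n = set_coord (h n) i (x ord0 i).
  apply/rowP => j; rewrite !mxE; case: eqP => [->|//].
  by rewrite /= ltnn.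
have -> : h n.+1 = set_coord (h n) i (y ord0 i).
  apply/rowP => j; rewrite !mxE ltnS leq_eqVlt -val_eqE /=.
  by case: eqP => //= E; rewrite (_ : j = i)//; exact: val_inj.
exact: W_set_coord.
Qed.

Definition dist2 (x y : 'rV[R]_d) : R :=
  \sum_i (mode L 1 (x ord0 i) - mode L 1 (y ord0 i)) ^+ 2.

Lemma dist2_ge0 x y : 0 <= dist2 x y.
Proof. by apply: sumr_ge0 => i _; exact: sqr_ge0. Qed.

(** After folding, both points lie in the compact box of side L / 2, where
    dist2 x y = 0 only if x = y.  On the compact set of pairs of the box with
    |W x - W y| >= e, the continuous function dist2 therefore has a positive
    minimum, and C is the maximum of |W x - W y| there divided by it. *)
Lemma W_oscillation e : 0 < e -> exists2 C, 0 <= C &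
  forall x y, `|W x - W y| <= e + C * dist2 x y.
Proof.
move=> e0.
pose B : set 'rV[R]_d := [set v | forall i, `[0, L / 2]%classic (v ord0 i)].
suff [C C0 HC] : exists2 C, 0 <= C & forall x y, B x -> B y ->
    `|W x - W y| <= e + C * dist2 x y.
  exists C => // x y.
  have /choice[f fP] := foldP L_gt0.
  have E z : W z = W (\row_i f (z ord0 i)).
    by apply: W_fold => i; rewrite mxE; case: (fP (z ord0 i)).
  have -> : dist2 x y = dist2 (\row_i f (x ord0 i)) (\row_i f (y ord0 i)).
    apply: eq_bigr => i _; rewrite !mxE.
    rewrite (mode_fold L_gt0 (fP (x ord0 i)).1).
    by rewrite (mode_fold L_gt0 (fP (y ord0 i)).1).
  rewrite (E x) (E y); apply: HC => i /=; rewrite mxE; exact: (fP _).2.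
have cB : compact B.
  apply: (@rV_compact R d (fun=> `[0, L / 2]%classic)) => i.
  exact: segment_compact.
pose g (p : 'rV[R]_d * 'rV[R]_d) := `|W p.1 - W p.2|.
pose s (p : 'rV[R]_d * 'rV[R]_d) := dist2 p.1 p.2.
have cg : continuous g.
  move=> p; apply: cvg_norm; apply: cvgB.
    by apply: cvg_comp; [exact: cvg_fst|exact: cW].
  by apply: cvg_comp; [exact: cvg_snd|exact: cW].
have cs : continuous s.
  apply: (@continuous_big R 'I_d +%R 0 xpredT (@add_continuous R) _ _
    (fun i (p : 'rV[R]_d * 'rV[R]_d) =>
      (mode L 1 (p.1 ord0 i) - mode L 1 (p.2 ord0 i)) ^+ 2)) => i _ p.
  have cc : continuous (fun v : 'rV[R]_d => mode L 1 (v ord0 i)).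
    move=> v; apply: continuous_comp; first exact: coord_continuous.
    exact: continuous_mode.
  have cd : {for p, continuous (fun p : 'rV[R]_d * 'rV[R]_d =>
      mode L 1 (p.1 ord0 i) - mode L 1 (p.2 ord0 i))}.
    apply: cvgB.
      exact: (@continuous_comp _ _ _ fst _ p cvg_fst (cc p.1)).
    exact: (@continuous_comp _ _ _ snd _ p cvg_snd (cc p.2)).
  exact: (cvgM cd cd).
pose K := (B `*` B) `&` [set p | e <= g p].
have cK : compact K.
  apply: compact_closedI; first exact: compact_setX.
  by apply: (@preimage_closed _ _ g [set t | e <= t]) => //; exact: closed_ge.
have [K0|/set0P/negP/negPn/eqP K0] := pselect (K !=set0); last first.
  exists 0 => // x y Bx By; rewrite mul0r addr0 leNgt; apply/negP => lt.
  have : K (x, y) by split => //=; rewrite /g/= ltW.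
  by rewrite K0.
have [p pK pmin] := compact_EVT_min K0 cK (continuous_subspaceT cs).
have [q qK qmax] := compact_EVT_max K0 cK (continuous_subspaceT cg).
have sp0 : 0 < s p.
  rewrite lt_neqAle dist2_ge0 andbT eq_sym; apply/negP.
  rewrite /s /dist2 psumr_eq0; last by move=> i _; exact: sqr_ge0.
  move=> /allP h; have [[B1 B2] /= ep] := set_mem pK.
  suff p12 : p.1 = p.2 by move: ep; rewrite /g p12 subrr normr0 leNgt e0.
  apply/rowP => i; apply: (mode_inj L_gt0); [exact: B1|exact: B2|].
  by have := h i (mem_index_enum i); rewrite sqrf_eq0 subr_eq0 => /eqP.
have gq0 : 0 <= g q by exact: normr_ge0.
exists (g q / s p); first by rewrite divr_ge0// ltW.
move=> x y Bx By.
have [le|/ltW lt] := leP `|W x - W y| e.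
  by rewrite (le_trans le)// lerDl mulr_ge0 ?dist2_ge0// divr_ge0// ltW.
have xyK : (x, y) \in K by apply/mem_set; split.
rewrite (le_trans (qmax _ xyK))// -[leLHS]add0r lerD// ?(ltW e0)//.
by rewrite mulrAC ler_pdivlMr// ler_wpM2l//; exact: pmin xyK.
Qed.

Lemma W_bounded : exists M, forall x, `|W x| <= M.
Proof.
have [C C0 HC] := W_oscillation ltr01.
(* Each square in dist2 is at most 4, being that of a difference of cosines. *)
exists (`|W 0| + (1 + C * (d%:R * 4))) => x.
rewrite -[X in `|X|](subrK (W 0)) addrC (le_trans (ler_normD _ _))//.
rewrite lerD2l (le_trans (HC x 0))// lerD2l ler_wpM2l//.
rewrite -[d in d%:R]card_ord -sumr_const mulr_suml ler_sum// => i _.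
rewrite mul1r.
have /ler_normlP[a1 a2] := mode_le1 L 1 (x ord0 i).
have /ler_normlP[b1 b2] := mode_le1 L 1 ((0 : 'rV[R]_d) ord0 i).
rewrite (_ : 4 = 2 ^+ 2); last by ring.
rewrite -real_normK ?num_real// ler_sqr ?nnegrE// ler_norml.
by apply/andP; split; lra.
Qed.
End potential.

(** * Measurability of continuous functions of tuples *)

Section measurable_vec.
Variables (R : realType) (d : nat) (W : 'rV[R]_d -> R).
Hypothesis cW : continuous W.

(** An open set is the union of the boxes with rational centre and radius
    1 / (n + 1) that it contains, and there are countably many of them. *)
Lemma measurable_continuous_vec :
  measurable_fun setT (fun x : Rpoint R d => W (vec x)).
Proof.
apply: (measurability (RGenOInfty.G (R := R))).
  exact: RGenOInfty.measurableE.
move=> _ [_ [a ->] <-]; rewrite setTI.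
pose box (p : 'rV[rat]_d * nat) : set (Rpoint R d) :=
  [set x | forall i, `|tnth x i - ratr (p.1 ord0 i)| < p.2.+1%:R^-1].
pose A := [set x : Rpoint R d | a < W (vec x)].
have -> : (fun x : Rpoint R d => W (vec x)) @^-1` `]a, +oo[%classic =
    \bigcup_p (if `[< box p `<=` A >] then box p else set0).
  apply/seteqP; split => [x|x [p _]]; last first.
    by case: asboolP => // pA /pA; rewrite /A/= in_itv/= andbT.
  rewrite /= in_itv/= andbT => ax.
  have : \forall y \near vec x, a < W y.
    have h : W @ vec x --> W (vec x) by exact: cW.
    exact: (@cvgr_gt R _ _ _ W _ h).
  move=> /nbhs_ballP[e /= e0 eA].
  have [n ne] : exists n, n.+1%:R^-1 < e / 2.
    have e20 : 0 < e / 2 by rewrite divr_gt0.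
    exists (Num.truncn (e / 2)^-1).
    by rewrite invf_plt ?posrE// truncnS_gt.
  have /choice[q qP] (i : 'I_d) :
      exists q : rat, `|tnth x i - ratr q| < n.+1%:R^-1.
    move: (tnth x i : R) => t.
    have n0 : 0 < n.+1%:R^-1 :> R by rewrite invr_gt0.
    have lt : t - n.+1%:R^-1 < t by rewrite ltrBlDr ltrDl.
    have [q] := rat_in_itvoo lt.
    rewrite in_itv/= => /andP[q1 q2]; exists q.
    move: (n.+1%:R^-1 : R) (ratr q : R) n0 q1 q2 => r s r0 q1 q2.
    by rewrite ltr_norml; apply/andP; split; lra.
  exists (\row_i q i, n) => //.
  have xb : box (\row_i q i, n) x by move=> i; rewrite mxE.
  case: asboolP => //; case => y yb; apply: eA.
  split => // i j; rewrite !mxE /ball/=.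
  have := xb j; have := yb j; rewrite /= mxE.
  move: (tnth x j : R) (tnth y j : R) (ratr (q j) : R) (n.+1%:R^-1 : R) ne.
  move=> s t r u ne.
  rewrite !ltr_norml => /andP[? ?] /andP[? ?]; apply/andP; split; lra.
apply: countable_bigcupT_measurable; first exact: countableP.
move=> p; case: asboolP => // _.
have -> : box p = \bigcap_i [set x : Rpoint R d |
    `|tnth x i - ratr (p.1 ord0 i)| < p.2.+1%:R^-1].
  by apply/seteqP; split => [x bx i _|x bx i]; exact: bx.
apply: fin_bigcap_measurable => [|i _]; first exact: finite_finset.
rewrite -[X in measurable X]setTI.
pose f (x : Rpoint R d) : R := `|tnth x i - ratr (p.1 ord0 i)|.
have mf : measurable_fun setT f.
  apply: measurableT_comp => //; apply: measurable_funB => //.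
  exact: measurable_tnth.
rewrite (_ : mkset _ = f @^-1` `]-oo, p.2.+1%:R^-1[%classic); last first.
  by apply/seteqP; split => x /=; rewrite in_itv.
exact: mf.
Qed.
End measurable_vec.

Lemma measurable_continuous_vecB (R : realType) (d : nat) (W : 'rV[R]_d -> R) :
  continuous W ->
  measurable_fun setT (fun z : Rpoint R d * Rpoint R d => W (vec z.1 - vec z.2)).
Proof.
move=> cW.
pose D (z : Rpoint R d * Rpoint R d) : Rpoint R d :=
  [tuple tnth z.1 i - tnth z.2 i | i < d].
have mD : measurable_fun setT D.
  apply/measurable_fun_tnthP => i.
  rewrite (_ : _ \o _ = fun z => tnth z.1 i - tnth z.2 i); last first.
    by apply/funext => z /=; rewrite tnth_mktuple.
  apply: measurable_funB.
    exact: (measurableT_comp (@measurable_tnth _ _ d i) measurable_fst).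
  exact: (measurableT_comp (@measurable_tnth _ _ d i) measurable_snd).
have := measurableT_comp (measurable_continuous_vec cW) mD.
congr (measurable_fun _ _); apply/funext => z /=; congr W.
by apply/rowP => i; rewrite !mxE tnth_mktuple.
Qed.

(** * Fejer means on the torus *)

Section approximation.
Variables (R : realType) (L : R) (d : nat) (W : 'rV[R]_d -> R).
Hypothesis L_gt0 : 0 < L.
Hypothesis W_periodic : torus_periodic L W.
Hypothesis W_even : coordinate_even W.
Hypothesis cW : continuous W.
Local Notation vol := (torus_volume L d).

Definition box_mode (k : 'I_d -> nat) (z : 'rV[R]_d) : R :=
  \prod_i mode L (k i) (z ord0 i).

Definition cos_coef (k : 'I_d -> nat) : R :=
  \int[vol]_u (W (vec u) * box_mode k (vec u)).

Definition box_weight N (k : {ffun 'I_d -> 'I_N}) : R :=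
  \prod_i fejer_weight L N (k i).

(** The Fejer mean of W of order N: the cosine expansion of W truncated to
    frequencies below N, with damped coefficients. *)
Definition smoothing N (z : 'rV[R]_d) : R :=
  \sum_(k : {ffun 'I_d -> 'I_N})
    box_weight k * cos_coef (fun i => k i) * box_mode (fun i => k i) z.

Definition box_fejer N (z : 'rV[R]_d) (u : Rpoint R d) : R :=
  \prod_i fejer L N (z ord0 i) (tnth u i).

Lemma box_fejerE N z u : box_fejer N z u =
  \sum_(k : {ffun 'I_d -> 'I_N})
     box_weight k * box_mode (fun i => k i) z * box_mode (fun i => k i) (vec u).
Proof.
rewrite /box_fejer /fejer bigA_distr_bigA/=; apply: eq_bigr => k _.
rewrite /box_weight /box_mode -!big_split/=.
by apply: eq_bigr => i _; rewrite mxE mulrA.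
Qed.

Lemma integrable_box_mode k : vol.-integrable setT
  (EFin \o (fun u => box_mode k (vec u))).
Proof.
have [+ _] := torus_integral_prod (fun i : 'I_d => integrable_mode L (k i)).
apply: eq_integrable => // u _ /=; congr EFin.
by apply: eq_bigr => i _; rewrite mxE.
Qed.

Lemma integrable_W_mul (g : Rpoint R d -> R) :
  vol.-integrable setT (EFin \o g) ->
  vol.-integrable setT (EFin \o (fun u => W (vec u) * g u)).
Proof.
move=> ig; have [M HM] := W_bounded L_gt0 W_periodic W_even cW.
apply: (@integrable_bounded_mul _ _ _ _ _ _ M) => //.
exact: measurable_continuous_vec.
Qed.

Lemma smoothingE N z :
  smoothing N z = \int[vol]_u (W (vec u) * box_fejer N z u).
Proof.
transitivity (\int[vol]_u \sum_(k : {ffun 'I_d -> 'I_N})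
    box_weight k * box_mode (fun i => k i) z *
      (W (vec u) * box_mode (fun i => k i) (vec u))); last first.
  apply: eq_Rintegral => u _; rewrite box_fejerE mulr_sumr.
  by apply: eq_bigr => k _; ring.
rewrite Rintegral_sum; last first.
  by move=> k; apply/integrable_RZ/integrable_W_mul/integrable_box_mode.
apply: eq_bigr => k _; rewrite RintegralZl//; last first.
  by apply/integrable_W_mul/integrable_box_mode.
by rewrite -/(cos_coef _); ring.
Qed.

Lemma integrable_box_fejer N z : vol.-integrable setT (EFin \o box_fejer N z).
Proof.
by have [] := torus_integral_prod (fun i => integrable_fejer L N (z ord0 i)).
Qed.

Lemma box_fejer_ge0 N z u : 0 <= box_fejer N z u.
Proof. by apply: prodr_ge0 => i _; exact: fejer_ge0. Qed.

Lemma box_fejer_mass N z : (0 < N)%N -> \int[vol]_u box_fejer N z u = 1.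
Proof.
move=> N0.
have [_ ->] := torus_integral_prod (fun i => integrable_fejer L N (z ord0 i)).
by rewrite big1// => i _; exact: fejer_mass.
Qed.

(** Multiplying box_fejer by a function of the i-th coordinate only changes its
   i-th factor, so the product remains of the form integrated by
   torus_integral_prod. *)
Let spread N (z : 'rV[R]_d) (i j : 'I_d) (t : R) : R :=
  if j == i then (mode L 1 t - mode L 1 (z ord0 j)) ^+ 2 * fejer L N (z ord0 j) t
  else fejer L N (z ord0 j) t.

Let spreadE N z i (u : Rpoint R d) : \prod_j spread N z i j (tnth u j) =
  (mode L 1 (tnth u i) - mode L 1 (z ord0 i)) ^+ 2 * box_fejer N z u.
Proof.
rewrite /box_fejer (bigD1 i)//= [in RHS](bigD1 i)//= /spread eqxx -mulrA.
by congr (_ * (_ * _)); apply: eq_bigr => j /negPf ->.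
Qed.

Let integrable_spread N z i j :
  (side_volume L).-integrable setT (EFin \o spread N z i j).
Proof.
have [->|ji] := eqVneq j i.
  have := integrable_fejer_variance L N (z ord0 i).
  by apply: eq_integrable => // t _; rewrite /= /spread eqxx.
have := integrable_fejer L N (z ord0 j).
by apply: eq_integrable => // t _; rewrite /= /spread (negPf ji).
Qed.

Lemma integrable_box_variance N (z : 'rV[R]_d) i : vol.-integrable setT
  (EFin \o (fun u => (mode L 1 (tnth u i) - mode L 1 (z ord0 i)) ^+ 2
     * box_fejer N z u)).
Proof.
have [+ _] := torus_integral_prod (integrable_spread N z i).
by apply: eq_integrable => // u _; rewrite /= spreadE.
Qed.

Lemma box_variance N (z : 'rV[R]_d) i : (2 < N)%N ->
  \int[vol]_u ((mode L 1 (tnth u i) - mode L 1 (z ord0 i)) ^+ 2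
     * box_fejer N z u) = N%:R^-1.
Proof.
move=> N2; under eq_Rintegral do rewrite -spreadE.
have [_ ->] := torus_integral_prod (integrable_spread N z i).
rewrite (bigD1 i)//= big1 ?mulr1.
  by under eq_Rintegral do rewrite /spread eqxx; exact: fejer_variance.
move=> j /negPf ji; under eq_Rintegral do rewrite /spread ji.
by apply: fejer_mass => //; exact: leq_trans N2.
Qed.

(** Since the kernel has mass one, smoothing N z - W z is the mean of W u - W z
    against it; the bound on W is averaged, and each coordinate contributes the
    variance 1 / N. *)
Lemma smoothing_error N e C : (2 < N)%N -> 0 <= C ->
  (forall x y, `|W x - W y| <= e + C * dist2 L x y) ->
  forall z, `|smoothing N z - W z| <= e + C * (d%:R / N%:R).
Proof.
move=> N2 C0 HC z.
have N0 : (0 < N)%N by exact: leq_trans N2.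
have iG := integrable_box_fejer N z.
have iWG := integrable_W_mul iG.
have iV := @integrable_Rsum _ _ _ vol _ (index_enum 'I_d) _
  (integrable_box_variance N z).
have -> : smoothing N z - W z =
    \int[vol]_u ((W (vec u) - W z) * box_fejer N z u).
  under eq_Rintegral do rewrite mulrBl.
  rewrite RintegralB//; last exact: integrable_RZ.
  by rewrite RintegralZl// box_fejer_mass// mulr1 smoothingE.
have iD : vol.-integrable setT
    (EFin \o (fun u => (W (vec u) - W z) * box_fejer N z u)).
  have := integrableB measurableT iWG (integrable_RZ (W z) iG).
  by apply: eq_integrable => // u _; rewrite /= mulrBl.
rewrite (le_trans (le_normr_Rintegral _ iD))//.
have -> : e + C * (d%:R / N%:R) = \int[vol]_u (e * box_fejer N z u +
   C * \sum_i ((mode L 1 (tnth u i) - mode L 1 (z ord0 i)) ^+ 2 * box_fejer N z u)).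
  rewrite RintegralD//; [|exact: integrable_RZ..].
  rewrite !RintegralZl// box_fejer_mass// mulr1 Rintegral_sum; last first.
    exact: integrable_box_variance.
  under eq_bigr do rewrite box_variance//.
  by rewrite sumr_const card_ord mulr_natl.
apply: le_Rintegral => //.
- exact: integrable_norm.
- have := integrableD measurableT (integrable_RZ e iG) (integrable_RZ C iV).
  by apply: eq_integrable.
move=> u _; rewrite normrM (ger0_norm (box_fejer_ge0 _ _ _)).
rewrite -mulr_suml mulrA -mulrDl.
rewrite ler_wpM2r ?box_fejer_ge0// (le_trans (HC _ _))//.
rewrite lerD2l ler_wpM2l// /dist2 le_eqVlt; apply/orP; left; apply/eqP.
by apply: eq_bigr => i _; rewrite mxE.
Qed.

Lemma smoothing_uniform e : 0 < e ->
  exists N, forall z, `|smoothing N z - W z| <= e.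
Proof.
move=> e0; have e20 : 0 < e / 2 by rewrite divr_gt0.
have [C C0 HC] := W_oscillation L_gt0 W_periodic W_even cW e20.
pose x := C * d%:R / (e / 2).
have x0 : 0 <= x by rewrite divr_ge0 ?mulr_ge0// ltW.
(* This N is larger than C d / (e / 2), and at least 3 as smoothing_error
   requires. *)
exists (Num.truncn x).+3 => z.
rewrite (le_trans (smoothing_error _ C0 HC z))//.
rewrite [leRHS](splitr e) lerD2l mulrA ler_pdivrMr// [leRHS]mulrC -ler_pdivrMr//.
rewrite -/x ltW// (lt_le_trans (truncnS_gt x))// ler_nat.
by rewrite ltnS ltnW.
Qed.

Lemma fourier_basis1_mode (n : nat) (t : R) : fourier_basis1 L n%:Z t = mode L n t.
Proof.
rewrite /fourier_basis1 ltz_nat; case: n => [|n] /=; first by rewrite mode0.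
by rewrite /mode /freq -pmulrn; congr cos; ring.
Qed.

Lemma fourier_norm_gt0 (k : 'rV[int]_d) : 0 < fourier_norm L k.
Proof.
rewrite /fourier_norm mulr_gt0 ?powR_gt0// prodr_gt0// => j _.
by rewrite sqrtr_gt0; case: (_ == 0); rewrite /= ?mulr1n ?mulr0n; lra.
Qed.

Lemma cos_coef_zero (k : 'I_d -> nat) :
  mean_zero L W -> (forall i, k i = 0%N) -> cos_coef k = 0.
Proof.
move=> W0 k0; rewrite -[RHS]W0; apply: eq_Rintegral => u _.
by rewrite /box_mode big1 ?mulr1// => i _; rewrite k0 mode0.
Qed.

(** For k = 0 this is the integral of W, which is zero; otherwise it is, up to
    the positive normalisation of the Fourier basis, the coefficient of W at
    k. *)
Lemma cos_coef_ge0 (k : 'I_d -> nat) :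
  mean_zero L W -> H_stable L W -> 0 <= cos_coef k.
Proof.
move=> W0 WH.
have [/forallP k0|/forallPn[i ki]] := boolP [forall i, k i == 0%N].
  by rewrite cos_coef_zero// => i; exact/eqP.
pose kz : 'rV[int]_d := \row_i (k i)%:Z.
have kz0 : kz != 0.
  by apply/eqP => /rowP/(_ i); rewrite !mxE => -[] /eqP; rewrite (negPf ki).
have := WH kz kz0.
have -> : fourier_coef L W kz = fourier_norm L kz * cos_coef k.
  rewrite /cos_coef -RintegralZl//; last first.
    exact/integrable_W_mul/integrable_box_mode.
  apply: eq_Rintegral => u _; rewrite /fourier_basis mulrCA; congr (_ * (_ * _)).
  by apply: eq_bigr => i' _; rewrite mxE fourier_basis1_mode.
by rewrite pmulr_rge0// fourier_norm_gt0.
Qed.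

(** * The interaction energy in Fourier variables *)

Definition wave1 (b : bool) (k : nat) (t : R) : R :=
  if b then sin (freq L k * t) else cos (freq L k * t).

Definition wave (k : 'I_d -> nat) (S : {ffun 'I_d -> bool}) (x : Rpoint R d) : R :=
  \prod_i wave1 (S i) (k i) (tnth x i).

(** Each factor is cos (a - b) = cos a cos b + sin a sin b; S selects, in every
    coordinate, the sine or the cosine term. *)
Lemma box_modeB k (x y : Rpoint R d) : box_mode k (vec x - vec y) =
  \sum_(S : {ffun 'I_d -> bool}) wave k S x * wave k S y.
Proof.
transitivity (\prod_i \sum_(b : bool)
    wave1 b (k i) (tnth x i) * wave1 b (k i) (tnth y i)).
  apply: eq_bigr => i _.
  by rewrite big_bool !mxE /wave1/= /mode mulrBr cosB addrC.
rewrite bigA_distr_bigA/=; apply: eq_bigr => S _.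
by rewrite /wave -big_split.
Qed.

Lemma wave1_le1 b k t : `|wave1 b k t| <= 1.
Proof. by rewrite /wave1; case: b; rewrite ?sin_max ?cos_max. Qed.

Lemma continuous_wave1 b k : continuous (wave1 b k).
Proof. by case: b; [exact: continuous_sinM|exact: continuous_cosM]. Qed.

Lemma measurable_wave k S : measurable_fun setT (wave k S).
Proof.
apply: measurable_prod => i _; apply: measurableT_comp; last exact: measurable_tnth.
by apply: continuous_measurable_fun; exact: continuous_wave1.
Qed.

Lemma wave_le1 k S x : `|wave k S x| <= 1.
Proof.
rewrite /wave normr_prod; apply: prodr_ile1 => i _.
by rewrite normr_ge0 wave1_le1.
Qed.

Lemma integrable_wave_mul k S (f : Rpoint R d -> R) :
  vol.-integrable setT (EFin \o f) ->
  vol.-integrable setT (EFin \o (fun x => wave k S x * f x)).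
Proof.
apply: (@integrable_bounded_mul _ _ _ _ _ _ 1); first exact: measurable_wave.
exact: wave_le1.
Qed.

(** A coordinate with nonzero frequency contributes a vanishing factor. *)
Lemma wave_mean0 k S : (exists i, k i != 0%N) -> \int[vol]_x wave k S x = 0.
Proof.
move=> [i ki].
have iw (j : 'I_d) : (side_volume L).-integrable setT (EFin \o wave1 (S j) (k j)).
  apply: (@continuous_bounded_side _ _ _ 1); first exact: continuous_wave1.
  exact: wave1_le1.
have [_ ->] := torus_integral_prod iw.
apply/eqP/prodf_eq0; exists i => //; apply/eqP.
rewrite /wave1; case: (S i); first exact: side_sin.
by apply: side_cos; rewrite // lt0n.
Qed.

(** The interaction energy of f for the smoothed potential: see
    [integrable_smoothing_interaction]. *)
Definition spectral_energy N (f : Rpoint R d -> R) : R :=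
  \sum_(k : {ffun 'I_d -> 'I_N}) box_weight k * cos_coef (fun i => k i) *
    \sum_(S : {ffun 'I_d -> bool})
      (\int[vol]_x (wave (fun i => k i) S x * f x)) ^+ 2.

Lemma box_weight_ge0 N (k : {ffun 'I_d -> 'I_N}) : 0 <= box_weight k.
Proof. by apply: prodr_ge0 => i _; exact: fejer_weight_ge0. Qed.

Lemma spectral_energy_ge0 N f :
  mean_zero L W -> H_stable L W -> 0 <= spectral_energy N f.
Proof.
move=> W0 WH; apply: sumr_ge0 => k _.
rewrite mulr_ge0 ?mulr_ge0 ?box_weight_ge0 ?cos_coef_ge0//.
by apply: sumr_ge0 => S _; exact: sqr_ge0.
Qed.

(** The modes k <> 0 integrate to zero, and for k = 0 the coefficient is the
    integral of W, which is zero. *)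
Lemma spectral_energy_cst N c : mean_zero L W -> spectral_energy N (cst c) = 0.
Proof.
move=> W0; apply: big1 => k _.
have [/forallP k0|/forallPn[i ki]] := boolP [forall i, (k i : nat) == 0%N].
  by rewrite cos_coef_zero// ?mulr0 ?mul0r// => i; exact/eqP.
rewrite big1 ?mulr0// => S _.
rewrite RintegralZr//; last first.
  apply: (@bounded_integrable _ _ _ _ _ 1); first exact: measurable_wave.
  exact: wave_le1.
by rewrite wave_mean0 ?mul0r ?expr0n//; exists i.
Qed.

Lemma smoothing_interactionE N (f : Rpoint R d -> R) (z : Rpoint R d * Rpoint R d) :
  smoothing N (vec z.1 - vec z.2) * f z.1 * f z.2 =
  \sum_(k : {ffun 'I_d -> 'I_N}) box_weight k * cos_coef (fun i => k i) *
    \sum_(S : {ffun 'I_d -> bool})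
      (wave (fun i => k i) S z.1 * f z.1) * (wave (fun i => k i) S z.2 * f z.2).
Proof.
rewrite /smoothing !mulr_suml; apply: eq_bigr => k _.
rewrite box_modeB -!mulrA; congr (_ * (_ * _)); rewrite !mulr_suml.
by apply: eq_bigr => S _; ring.
Qed.

Local Notation vol2 := (vol \x vol)%E.

Lemma integrable_smoothing_interaction N f : vol.-integrable setT (EFin \o f) ->
  vol2.-integrable setT
    (EFin \o (fun z => smoothing N (vec z.1 - vec z.2) * f z.1 * f z.2)) /\
  \int[vol2]_z (smoothing N (vec z.1 - vec z.2) * f z.1 * f z.2) =
    spectral_energy N f.
Proof.
move=> fi.
have iS (k : {ffun 'I_d -> 'I_N}) S : vol2.-integrable setT (EFin \o (fun z =>
    (wave (fun i => k i) S z.1 * f z.1) * (wave (fun i => k i) S z.2 * f z.2))).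
  have iw := integrable_wave_mul (fun i => k i) S fi.
  exact: (integrable_tensor iw iw).
have iK (k : {ffun 'I_d -> 'I_N}) :=
  integrable_Rsum (index_enum {ffun 'I_d -> bool}) (iS k).
have iZ (k : {ffun 'I_d -> 'I_N}) :=
  integrable_RZ (box_weight k * cos_coef (fun i => k i)) (iK k).
split.
  have := integrable_Rsum (index_enum _) iZ.
  by apply: eq_integrable => // z _; rewrite /= smoothing_interactionE.
under eq_Rintegral do rewrite smoothing_interactionE.
rewrite Rintegral_sum//; apply: eq_bigr => k _.
rewrite RintegralZl//; congr (_ * _).
rewrite Rintegral_sum//; apply: eq_bigr => S _.
have iw := integrable_wave_mul (fun i => k i) S fi.
by rewrite (Rintegral_tensor iw iw) expr2.
Qed.

(** A uniform error e on the potential changes the energy by at most e times the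
    square of the mass of f. *)
Lemma interaction_approx e f : 0 < e -> vol.-integrable setT (EFin \o f) ->
  (forall x, 0 <= f x) -> \int[vol]_x f x = 1 ->
  vol2.-integrable setT (fun z => (interaction W f z)%:E) ->
  exists N, `|\int[vol2]_z interaction W f z - spectral_energy N f| <= e.
Proof.
move=> e0 fi f0 f1 iI.
have [N HN] := smoothing_uniform e0; exists N.
have [iA <-] := integrable_smoothing_interaction N fi.
rewrite -RintegralB//.
have iff : vol2.-integrable setT (EFin \o (fun z => f z.1 * f z.2)).
  exact: (integrable_tensor fi fi).
have -> : e = \int[vol2]_z (e * (f z.1 * f z.2)).
  by rewrite RintegralZl// (Rintegral_tensor fi fi) f1 !mulr1.
have iD := integrableB measurableT iI iA.
rewrite (le_trans (le_normr_Rintegral _ _))//.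
apply: le_Rintegral => //.
- exact: integrable_norm.
- exact: integrable_RZ.
move=> z _; rewrite /interaction -!mulrA -mulrBl.
by rewrite normrM (ger0_norm (mulr_ge0 (f0 _) (f0 _))) ler_wpM2r ?mulr_ge0// distrC.
Qed.
End approximation.

(** * The integral of a power of a density *)

(** For t > 0, write t ^ m = t exp ((m - 1) ln t) and use exp x >= 1 + x twice,
    first at (m - 1) ln t, then at - ln t in the form t ln t >= t - 1; the second
    use is strict unless t = 1. *)
Lemma powR_tangent (R : realType) (m t : R) : 1 < m -> 0 <= t ->
  1 + m * (t - 1) <= t `^ m ?= iff (t == 1).
Proof.
move=> m1; rewrite le_eqVlt => /predU1P[<-|t0].
  have m0 : m != 0 by rewrite gt_eqF// (lt_trans ltr01).
  apply/leifP; rewrite eq_sym oner_eq0 powR0//; lra.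
have [->|t1] := eqVneq t 1.
  by apply/leifP; rewrite powR1 subrr mulr0 addr0.
apply/leifP => /=.
have E : t `^ m = t * expR ((m - 1) * ln t).
  rewrite /powR gt_eqF// -{2}(lnK (x := t)) ?posrE// -expRD; congr expR; ring.
have h1 : 1 - t^-1 < ln t.
  have := @expR_gt1Dx R (- ln t).
  rewrite oppr_eq0 ln_eq0// => /(_ t1).
  rewrite expRN lnK ?posrE//; lra.
have h2 : t - 1 < t * ln t.
  have -> : t - 1 = t * (1 - t^-1) by rewrite mulrBr mulr1 divff// gt_eqF.
  by rewrite ltr_pM2l.
rewrite E (@lt_le_trans _ _ (t * (1 + (m - 1) * ln t)))//; last first.
  by rewrite ler_pM2l// expR_ge1Dx.
have : (m - 1) * (t - 1) < (m - 1) * (t * ln t) by rewrite ltr_pM2l// subr_gt0.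
lra.
Qed.

Section power_integral.
Context d (T : measurableType d) (R : realType).
Variables (mu : {finite_measure set T -> \bar R}) (V m : R) (f : T -> R).
Hypotheses (muT : mu setT = V%:E) (V_gt0 : 0 < V) (m_gt1 : 1 < m).
Hypotheses (f_ge0 : forall x, 0 <= f x) (fi : mu.-integrable setT (EFin \o f)).
Hypotheses (f1 : \int[mu]_x f x = 1).
Hypothesis fmi : mu.-integrable setT (EFin \o (fun x => f x `^ m)).

Let tangent x := V^-1 `^ m * (1 + m * (V * f x - 1)).

Let tangent_le x : tangent x <= f x `^ m ?= iff (f x == V^-1).
Proof.
have V0 : V != 0 by rewrite gt_eqF.
have -> : f x `^ m = V^-1 `^ m * (V * f x) `^ m.
  by rewrite -powRM ?invr_ge0 ?mulr_ge0 ?(ltW V_gt0)// mulKf.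
have -> : (f x == V^-1) = (V * f x == 1).
  by rewrite -(inj_eq (mulfI V0)) divff.
have c0 : 0 < V^-1 `^ m by rewrite powR_gt0// invr_gt0.
have H := @powR_tangent R m (V * f x) m_gt1 (mulr_ge0 (ltW V_gt0) (f_ge0 x)).
split; first by rewrite ler_pM2l//; exact: H.1.
by rewrite -H.2 /tangent (inj_eq (mulfI _))// gt_eqF.
Qed.

Let tangentE x : tangent x = V^-1 `^ m * (1 - m) + (V^-1 `^ m * m * V) * f x.
Proof. by rewrite /tangent; ring. Qed.

Let integrable_tangent : mu.-integrable setT (EFin \o tangent).
Proof.
have := integrableD measurableT
  (finite_measure_integrable_cst mu (V^-1 `^ m * (1 - m)) measurableT)
  (integrable_RZ (V^-1 `^ m * m * V) fi).
by apply: eq_integrable => // x _; rewrite /= tangentE.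
Qed.

Let Rintegral_tangent : \int[mu]_x tangent x = V^-1 `^ m * V.
Proof.
under eq_Rintegral do rewrite tangentE.
rewrite RintegralD//; [|exact: finite_measure_integrable_cst|exact: integrable_RZ].
by rewrite Rintegral_cst// RintegralZl// f1 [fine _](congr1 fine muT) /=; ring.
Qed.

(** The tangent is affine in f x, and f has integral one, so the integral of the
    tangent does not depend on f. *)
Lemma Rintegral_powR_ge : V^-1 `^ m * V <= \int[mu]_x (f x `^ m).
Proof.
rewrite -Rintegral_tangent; apply: le_Rintegral => // x _.
exact: (tangent_le x).1.
Qed.

(** The gap between f ^ m and its tangent is nonnegative; if its integral is zero
    it vanishes almost everywhere, where f touches the point of tangency. *)
Lemma Rintegral_powR_le_ae : \int[mu]_x (f x `^ m) <= V^-1 `^ m * V ->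
  ae_eq mu setT (EFin \o f) (cst V^-1%:E).
Proof.
move=> le.
pose g x := f x `^ m - tangent x.
have g0 x : 0 <= g x by rewrite subr_ge0; exact: (tangent_le x).1.
have gi : mu.-integrable setT (EFin \o g).
  by have := integrableB measurableT fmi integrable_tangent; apply: eq_integrable.
have int0 : \int[mu]_x g x = 0.
  apply/eqP; rewrite eq_le Rintegral_ge0// andbT.
  by rewrite RintegralB// Rintegral_tangent subr_le0.
have : ae_eq mu setT (EFin \o g) (cst 0%E).
  apply/ae_eq_integral_abs => //; first exact: measurable_int gi.
  under eq_integral do rewrite gee0_abs ?lee_fin//.
  by rewrite -[LHS]fineK ?integrable_fin_num// [fine _]int0.
apply: filterS => x /(_ I) [gx] _; congr EFin; apply/eqP.
by rewrite -(tangent_le x).2 eq_sym -subr_eq0; exact/eqP.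
Qed.
End power_integral.

(** * Minimisers of the free energy *)

Section free_energy_minimiser.
Variables (R : realType) (L : R) (d : nat) (W : 'rV[R]_d -> R) (beta m : R).
Hypothesis L_gt0 : 0 < L.
Hypothesis W_periodic : torus_periodic L W.
Hypothesis W_even : coordinate_even W.
Hypothesis cW : continuous W.
Hypothesis W_mean0 : mean_zero L W.
Hypothesis W_Hstable : H_stable L W.
Hypothesis (m_gt1 : 1 < m) (beta_gt0 : 0 < beta).
Local Notation vol := (torus_volume L d).
Local Notation vol2 := (vol \x vol)%E.
Local Notation V := (L ^+ d).

Let V_gt0 : 0 < V. Proof. exact: exprn_gt0. Qed.

Lemma density_integrable (nu : probability (Rpoint R d) R) f : is_density L nu f ->
  vol.-integrable setT (EFin \o f) /\ \int[vol]_x f x = 1.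
Proof.
move=> [mf f0 fE].
have f1 : (\int[vol]_x (f x)%:E = 1)%E.
  by rewrite -fE//; exact: probability_setT.
split; last by rewrite /Rintegral f1.
apply/integrableP; split; first exact/measurable_EFinP.
under eq_integral do rewrite gee0_abs ?lee_fin//.
by rewrite f1 ltry.
Qed.

Lemma interaction_ge0 f : vol.-integrable setT (EFin \o f) ->
  (forall x, 0 <= f x) -> \int[vol]_x f x = 1 ->
  vol2.-integrable setT (fun z => (interaction W f z)%:E) ->
  0 <= \int[vol2]_z interaction W f z.
Proof.
move=> fi f0 f1 iI; apply/ler_addgt0Pr => e e0.
have [N] := interaction_approx L_gt0 W_periodic W_even cW e0 fi f0 f1 iI.
have := spectral_energy_ge0 L_gt0 W_periodic W_even cW N f W_mean0 W_Hstable.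
by rewrite ler_norml => + /andP[]; lra.
Qed.

(** The spectral energies only see f up to null sets, so they are those of the
    constant density. *)
Lemma interaction_uniform f : vol.-integrable setT (EFin \o f) ->
  (forall x, 0 <= f x) -> \int[vol]_x f x = 1 ->
  vol2.-integrable setT (fun z => (interaction W f z)%:E) ->
  ae_eq vol setT (EFin \o f) (cst V^-1%:E) ->
  \int[vol2]_z interaction W f z = 0.
Proof.
move=> fi f0 f1 iI fV.
have E N : spectral_energy L W N f = 0.
  rewrite -(spectral_energy_cst L_gt0 N V^-1 W_mean0).
  apply: eq_bigr => k _; congr (_ * _); apply: eq_bigr => S _; congr (_ ^+ 2).
  congr fine; apply: ae_eq_integral => //.
  - have := integrable_wave_mul (fun i => k i) S fi.
    exact: measurable_int.
  - apply/measurable_EFinP; apply: measurable_funM => //.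
    exact: measurable_wave.
  - by apply: filterS fV => x /(_ I)[fx] _; rewrite /= fx.
apply/eqP; rewrite -normr_le0; apply/ler_addgt0Pr => e e0.
have [N] := interaction_approx L_gt0 W_periodic W_even cW e0 fi f0 f1 iI.
by rewrite E subr0 add0r.
Qed.

Definition min_energy : R :=
  beta^-1 / (m - 1) * (V^-1 `^ m * V) - beta^-1 / (m - 1).

Let coef_gt0 : 0 < beta^-1 / (m - 1).
Proof. by rewrite divr_gt0 ?invr_gt0 ?subr_gt0. Qed.

Lemma density_energy_ge (nu : probability (Rpoint R d) R) f :
  is_density L nu f -> finite_energy L W m f ->
  min_energy <= density_energy L W beta m f.
Proof.
move=> df [fmi iI]; have [fi f1] := density_integrable df; case: df => _ f0 _.
rewrite /min_energy /density_energy -[leLHS]addr0 lerD//.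
  rewrite lerD2r ler_pM2l//.
  exact: Rintegral_powR_ge (torus_volumeT L_gt0 d) V_gt0 m_gt1 f0 fi f1 fmi.
by rewrite mulr_ge0 ?invr_ge0// (interaction_ge0 fi f0 f1 iI).
Qed.

Lemma density_energy_le_ae (nu : probability (Rpoint R d) R) f :
  is_density L nu f -> finite_energy L W m f ->
  density_energy L W beta m f <= min_energy ->
  ae_eq vol setT (EFin \o f) (cst V^-1%:E).
Proof.
move=> df [fmi iI]; have [fi f1] := density_integrable df; case: df => _ f0 _ le.
apply: (Rintegral_powR_le_ae (torus_volumeT L_gt0 d) V_gt0 m_gt1 f0 fi f1 fmi).
rewrite -(ler_pM2l coef_gt0) -(lerD2r (- (beta^-1 / (m - 1)))).
apply: le_trans le; rewrite /density_energy lerDl.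
by rewrite mulr_ge0 ?invr_ge0// (interaction_ge0 fi f0 f1 iI).
Qed.

Lemma density_energy_ae (nu : probability (Rpoint R d) R) f :
  is_density L nu f -> finite_energy L W m f ->
  ae_eq vol setT (EFin \o f) (cst V^-1%:E) ->
  density_energy L W beta m f = min_energy.
Proof.
move=> df [fmi iI] fV; have [fi f1] := density_integrable df; case: df => mf f0 _.
rewrite /density_energy (interaction_uniform fi f0 f1 iI fV) mulr0 addr0.
rewrite /min_energy; congr (_ * _ - _).
transitivity (\int[vol]_x (V^-1 `^ m)); last first.
  rewrite Rintegral_cst//; congr (_ * _).
  exact: (congr1 (@fine R) (torus_volumeT L_gt0 d)).
congr fine; apply: ae_eq_integral => //; first exact: measurable_int fmi.
by apply: filterS fV => x /(_ I)[fx] _; rewrite /= fx.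
Qed.

Lemma density_ae_unique (nu : probability (Rpoint R d) R) f f' :
  is_density L nu f -> is_density L nu f' ->
  ae_eq vol setT (EFin \o f) (EFin \o f').
Proof.
move=> df df'; have [fi _] := density_integrable df.
case: df => mf f0 fE; case: df' => mf' f0' fE'.
apply: integral_ae_eq => //; first exact/measurable_EFinP.
by move=> A _ mA; rewrite -fE// -fE'.
Qed.

Lemma finite_energy_cst c : 0 <= c -> finite_energy L W m (cst c).
Proof.
move=> c0; split.
  exact: (finite_measure_integrable_cst vol (c `^ m) measurableT).
have [M HM] := W_bounded L_gt0 W_periodic W_even cW.
have i1 : vol2.-integrable setT (EFin \o (fun z => c * c)).
  by apply: (@integrable_tensor _ _ _ _ _ vol vol (cst c) (cst c));
    exact: finite_measure_integrable_cst.
have := @integrable_bounded_mul _ _ _ vol2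
  (fun z => W (vec z.1 - vec z.2)) _ M (measurable_continuous_vecB cW)
  (fun z => HM _) i1.
by apply: eq_integrable => // z _; rewrite /interaction/= mulrA.
Qed.

Lemma uniform_probability : exists mu : probability (Rpoint R d) R,
  is_density L mu (cst V^-1) /\ on_torus L mu.
Proof.
(* The Dirac mass is the default value of the normalisation when the total mass
   is zero or infinite. *)
pose mu : probability (Rpoint R d) R := mnormalize vol (dirac point).
have muE A : mu A = (vol A * V^-1%:E)%E.
  have volT := torus_volumeT L_gt0 d.
  rewrite /mu/= /mnormalize; case: ifPn => [|_].
    by move=> /orP[]/eqP; rewrite [LHS]volT => -[] // /eqP; rewrite (gt_eqF V_gt0).
  congr (_ * _%:E)%E; exact: (congr1 (fun v => (fine v)^-1) volT).
exists mu; split.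
  split => //; first by move=> x; rewrite invr_ge0 ltW.
  by move=> A mA; rewrite muE muleC; exact: (esym (integral_cst vol mA _)).
rewrite /on_torus muE torus_volume_cell// -EFinM divff// gt_eqF//.
Qed.

(** The energy is computed from a density that need not be the constant function
    itself, but agrees with it almost everywhere. *)
Lemma free_energy_uniform (mu : probability (Rpoint R d) R) :
  is_density L mu (cst V^-1) -> free_energy L W beta m mu = min_energy%:E.
Proof.
move=> dmu; rewrite /free_energy; case: pselect => [ex|[]]; last first.
  exists (cst V^-1); split => //; apply: finite_energy_cst.
  by rewrite invr_ge0 ltW.
case: (cid ex) => f [df ff] /=; congr EFin.
by apply: (density_energy_ae df ff); exact: (density_ae_unique df dmu).
Qed.
End free_energy_minimiser.

Unset Implicit Arguments.

Theorem theorem5p7 (R : realType) (d : nat) (L : R) (W : 'rV[R]_d -> R)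
    (m beta : R) (d_gt0 : (0 < d)%N) (L_gt0 : 0 < L)
    (W_periodic : torus_periodic L W) (W_C2 : C2 W) (W_even : coordinate_even W)
    (W_mean0 : mean_zero L W) (W_Hstable : H_stable L W)
    (m_gt1 : 1 < m) (beta_gt0 : 0 < beta) :
  exists mu : probability (Rpoint R d) R,
    [/\ is_density L mu (fun=> (L ^+ d)^-1),
        is_minimiser L W beta m mu
      & forall nu : probability (Rpoint R d) R,
          is_minimiser L W beta m nu ->
          forall A : set (Rpoint R d), measurable A -> nu A = mu A].
Proof.
have [cW _ _] := W_C2.
have [mu [dmu tmu]] := uniform_probability d L_gt0.
have muE := free_energy_uniform beta m L_gt0 W_periodic W_even cW W_mean0 dmu.
exists mu; split => //.
- split => // nu _; rewrite muE /free_energy.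
  case: pselect => [ex|_]; last by rewrite leey.
  case: (cid ex) => f [df ff] /=; rewrite lee_fin.
  exact: density_energy_ge df ff.
- move=> nu [_ /(_ _ tmu)]; rewrite muE /free_energy.
  case: pselect => [ex|_]; last by rewrite leye_eq.
  case: (cid ex) => f [df ff] /=; rewrite lee_fin => le A mA.
  have fV := density_energy_le_ae L_gt0 W_periodic W_even cW W_mean0 W_Hstable
    m_gt1 beta_gt0 df ff le.
  case: df => mf f0 ->//; case: dmu => mc c0 ->//.
  apply: ae_eq_integral => //.
  + by apply/measurable_EFinP; exact: measurable_funTS.
  + by apply/measurable_EFinP; exact: measurable_cst.
  + by apply: filterS fV => x /(_ I) fx _; exact: fx.
Qed.
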